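(* There is an absolute constant $n_0$ such that the following holds for all integers $n\ge n_0$. Let $a,b$ be positive integers with $a\le n/(4\ln n)$, and let $d$ be an integer with $$d<\frac{a}{a+b}\,n-\frac{6ab}{(a+b)^{3/2}}\sqrt{n\ln n}.$$ Then Maker has a winning strategy in the $(a:b)$-degree game on $K_n$ with prescribed degree $d$.
   Context: The $(a:b)$-degree game on $K_n$ with prescribed degree $d$ (also called $(a:b)$-MINDEG$(d)$) is the following two-player, perfect-information game on the edge set of the complete graph $K_n$. Maker and Breaker alternately claim previously unclaimed edges, Maker moving first. In each of his turns Maker claims $a$ unclaimed edges, and in each of his turns Breaker claims $b$ unclaimed edges (a player claims all remaining edges if fewer remain than he should claim). The game ends when all edges are claimed. Maker wins if and only if at the end he has claimed at least $d$ edges incident to each vertex of $K_n$; otherwise Breaker wins. $\ln$ denotes the natural logarithm. *)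

(* Defs.v *)
From HB Require Import structures.
From mathcomp Require Import all_boot all_order all_algebra.
From mathcomp Require Import reals exp.

Set Implicit Arguments.
Unset Strict Implicit.
Unset Printing Implicit Defensive.

Import Order.TTheory GRing.Theory Num.Theory.

(** Biased (a:b) positional games on a board [E].  A history is the sequence of
    the moves made so far, oldest first; a move is the set of elements claimed
    in one turn.  Maker makes the moves of even index, Breaker those of odd
    index. *)
Section PositionalGame.
Variables (T : finType) (E : {set T}) (a b : nat).

Implicit Types (h : seq {set T}) (X : {set T}).

Definition unclaimed h : {set T} := E :\: \bigcup_(X <- h) X.

Definition maker_claimed h : {set T} :=
  \bigcup_(i < size h | ~~ odd i) nth set0 h i.

Definition bias (i : nat) : nat := if odd i then b else a.

(* The condition [unclaimed h != set0] says that no move is made once the game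
   is over; the [minn] is the rule for the last turn, when too few elements
   may remain. *)
Definition legal_move h X : bool :=
  [&& unclaimed h != set0, X \subset unclaimed h &
      #|X| == minn (bias (size h)) #|unclaimed h| ].

Definition legal_history h : Prop :=
  forall i, i < size h -> legal_move (take i h) (nth set0 h i).

Definition game_over h : bool := unclaimed h == set0.

Definition strategy := seq {set T} -> {set T}.

Definition follows_maker (s : strategy) h : Prop :=
  forall i, i < size h -> ~~ odd i -> nth set0 h i = s (take i h).

(* [win M] : Maker wins a finished play in which he has claimed exactly [M].
   The first clause makes [s] always prescribe a legal move, so that the second
   one cannot hold for want of plays following [s]. *)
Definition maker_winning_strategy (win : {set T} -> Prop) (s : strategy) : Prop :=
  (forall h, legal_history h -> follows_maker s h ->
     ~~ odd (size h) -> ~~ game_over h -> legal_move h (s h)) /\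
  (forall h, legal_history h -> follows_maker s h ->
     game_over h -> win (maker_claimed h)).

Definition maker_wins (win : {set T} -> Prop) : Prop :=
  exists s : strategy, maker_winning_strategy win s.

End PositionalGame.

Definition complete_edges (n : nat) : {set {set 'I_n}} := [set e : {set 'I_n} | #|e| == 2].

Definition degree (n : nat) (M : {set {set 'I_n}}) (v : 'I_n) : nat :=
  #|[set e : {set 'I_n} in M | v \in e]|.

(* [d] ranges over all integers; a negative [d] is no constraint. *)
Definition mindeg_win (n : nat) (d : int) (M : {set {set 'I_n}}) : Prop :=
  forall v : 'I_n, (d <= (degree M v)%:Z)%R.

Definition maker_wins_mindeg (n a b : nat) (d : int) : Prop :=
  maker_wins (complete_edges n) a b (@mindeg_win n d).

(* Main.v *)
Require Import Defs.
From HB Require Import structures.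
From mathcomp Require Import all_boot all_order all_algebra.
From mathcomp Require Import reals sequences exp.
From mathcomp Require Import ring lra.

Set Implicit Arguments.
Unset Strict Implicit.
Unset Printing Implicit Defensive.

Import Order.TTheory GRing.Theory Num.Theory.
Local Open Scope ring_scope.

(** Maker plays greedily against an exponential potential.  Give each vertex [v]
    the weight [x ^ B(v) * y ^ M(v)], with [x >= 1 >= y >= 0], where [B(v)] and
    [M(v)] are the current degrees of [v] in the graphs of Breaker and Maker,
    and give each edge the sum of the weights of its ends.  Every turn Maker
    takes, one after the other, [a] free edges of largest current weight.
    Weights only fall during that turn, so if [w] is the largest weight of an
    edge that is still free at its end, then each of the [a] edges was worth at
    least [w] when taken and the total weight fell by at least [a * (1 - y) * w].
    Breaker then takes at most [b] edges worth at most [w] each, and by convexity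
    of [k |-> x ^ k] the total weight rises by at most [(x ^ b - 1) * w], however
    these edges are spread over the vertices.  Hence if
    [x ^ b - 1 <= a * (1 - y)], the total weight never exceeds its initial
    value [n].  The argument works for any finite family of subsets of a board,
    and [maker_wins_potential] states it so; here the subsets are the stars of
    the vertices.

    In the end every single weight is thus at most [n].  With [x = exp (t / b)],
    [y = exp (- u / a)] and [u = t / (1 - 2 * t)] the condition on [x] and [y]
    holds ([expR_rates_balanced]), and a vertex with fewer than [d] Maker edges
    would have weight at least [exp (t / b * (n - d) - u / a * d)].  For [u = t]
    and [d = a * n / (a + b)] this exponent would vanish; lowering [d] to the
    given bound gains at least [6 * t * sqrt (n * ln n / (a + b))], whereas
    [u > t] costs only [n * (u - t) / (a + b)], which is quadratic in [t].
    Taking [t = sqrt (n * ln n * (a + b)) / (3 * n)] brings the exponent above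
    [ln n] ([rates_exist]), which is a contradiction. *)

(** * The potential and its change in one turn *)

(** Convexity of [k |-> x ^ k]: on [0, m] it lies below its chord. *)
Lemma expr_chord (R : realDomainType) (x : R) (k m : nat) :
  1 <= x -> (k <= m)%N -> m%:R * (x ^+ k - 1) <= k%:R * (x ^+ m - 1).
Proof.
move=> x1; elim: m => [|m IH]; first by rewrite leqn0 => /eqP->; rewrite !mul0r.
rewrite leq_eqVlt => /orP[/eqP-> //|]; rewrite ltnS => km.
have /IH {}IH := km.
have step : x ^+ k - 1 <= k%:R * (x ^+ m.+1 - x ^+ m).
  have -> : k%:R * (x ^+ m.+1 - x ^+ m) = (x - 1) * (k%:R * x ^+ m).
    by rewrite exprS; ring.
  rewrite subrX1 ler_wpM2l ?subr_ge0 //.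
  rewrite mulr_natl -[k in _ *+ k]card_ord -sumr_const ler_sum // => i _.
  by rewrite ler_weXn2l // (leq_trans (ltnW (ltn_ord i))).
have -> : m.+1%:R * (x ^+ k - 1) = m%:R * (x ^+ k - 1) + (x ^+ k - 1).
  by rewrite -natr1; ring.
have -> : k%:R * (x ^+ m.+1 - 1) =
  k%:R * (x ^+ m - 1) + k%:R * (x ^+ m.+1 - x ^+ m) by ring.
exact: lerD.
Qed.

Section Potential.
Variables (R : realDomainType) (T V : finType) (A : V -> {set T}) (x y : R).
Implicit Types (M B X U F : {set T}) (e : T) (v : V).

Definition weight M B v : R := x ^+ #|A v :&: B| * y ^+ #|A v :&: M|.

Definition potential M B : R := \sum_v weight M B v.

(** When [A v] is the set of edges at [v], this is the sum of the weights of the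
    two ends of [e]. *)
Definition elt_weight M B e : R := \sum_(v | e \in A v) weight M B v.

Hypotheses (x1 : 1 <= x) (y0 : 0 <= y) (y1 : y <= 1).

Lemma weight_ge0 M B v : 0 <= weight M B v.
Proof. by rewrite mulr_ge0 // exprn_ge0 // (le_trans ler01). Qed.

Lemma elt_weight_setU1_le M B e e' : elt_weight (e' |: M) B e <= elt_weight M B e.
Proof.
apply: ler_sum => v _; rewrite ler_wpM2l ?exprn_ge0 ?(le_trans ler01) //.
by rewrite ler_wiXn2l // subset_leq_card // setIS // subsetUr.
Qed.

Lemma potential_setU1 M B e : e \notin M ->
  potential (e |: M) B = potential M B - (1 - y) * elt_weight M B e.
Proof.
move=> eM; rewrite /potential [elt_weight M B e]big_mkcond mulr_sumr -sumrB /=.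
apply: eq_bigr => v _; rewrite /weight.
case: ifP => ev; last first.
  rewrite mulr0 subr0; congr (_ * _ ^+ _); apply: eq_card => z.
  by rewrite !inE; case: eqP => // ->; rewrite ev.
have -> : A v :&: (e |: M) = e |: A v :&: M.
  by apply/setP=> z; rewrite !inE; case: eqP => // ->; rewrite ev.
by rewrite cardsU1 !inE (negPf eM) andbF add1n exprS; ring.
Qed.

(** What Maker's turn has to achieve when [U] is the set of free elements.  The
    weights in the last clause are those after the turn, and the elements are
    those left to Breaker: this is what bounds his next turn.  A boolean
    predicate lets a strategy pick such a set. *)
Definition good_reply M B U (k : nat) X : bool :=
  [&& X \subset U, #|X| == k, potential (M :|: X) B <= potential M B &
   [forall e in U :\: X, potential (M :|: X) B +
      k%:R * ((1 - y) * elt_weight (M :|: X) B e) <= potential M B]].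

(** The greedy choice works, by induction on [k].  The next element [e] is
    heaviest among the free ones, so taking it lowers the potential by at least
    [(1 - y)] times the weight of any [e'] still free.  Since the weight of [e']
    falls meanwhile, the [k] earlier terms remain bounded by the induction
    hypothesis for the same [e']. *)
Lemma good_reply_exists M B U (k : nat) : [disjoint U & M] -> (k <= #|U|)%N ->
  exists X, good_reply M B U k X.
Proof.
move=> UM; elim: k => [_|k IH kU].
  exists set0; rewrite /good_reply sub0set cards0 eqxx setU0 lexx /=.
  by apply/forall_inP=> e _; rewrite mul0r addr0.
have [X /and4P[XU /eqP Xk XP /forall_inP Xe]] := IH (ltnW kU).
have /card_gt0P[e0 e0UX] : (0 < #|U :\: X|)%N.
  by rewrite cardsD (setIidPr XU) Xk subn_gt0.
case: (arg_maxP (elt_weight (M :|: X) B) e0UX) => e /setDP[eU eX] emax.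
have eM : e \notin M :|: X by rewrite inE negb_or eX (disjointFr UM eU).
exists (e |: X); rewrite /good_reply setUCA potential_setU1 //.
have g0 e' : 0 <= (1 - y) * elt_weight (M :|: X) B e'.
  by rewrite mulr_ge0 ?subr_ge0 // sumr_ge0 // => v _; exact: weight_ge0.
apply/and4P; split.
- by rewrite subUset sub1set eU.
- by rewrite cardsU1 eX Xk.
- by rewrite (le_trans _ XP) // gerBl.
apply/forall_inP=> e'; rewrite !inE negb_or => /andP[/andP[_ e'X] e'U].
have e'UX : e' \in U :\: X by rewrite inE e'X.
apply: le_trans (Xe _ e'UX).
have le1 : (1 - y) * elt_weight (e |: (M :|: X)) B e' <= (1 - y) * elt_weight (M :|: X) B e'.
  by rewrite ler_wpM2l ?subr_ge0 ?elt_weight_setU1_le.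
have le2 : (1 - y) * elt_weight (M :|: X) B e' <= (1 - y) * elt_weight (M :|: X) B e.
  by rewrite ler_wpM2l ?subr_ge0 //; exact: emax.
have le3 := ler_wpM2l (ler0n R k) le1.
rewrite -natr1; lra.
Qed.

(** With [f v] the number of elements of [F] in [A v], the rise is the sum of
    [weight v * (x ^ f v - 1)], and [b * (x ^ f v - 1) <= f v * (x ^ b - 1)] by
    convexity.  Exchanging sums turns the sum of the [f v * weight v] into the
    sum over [F] of the element weights.  The bound [c] is the room that Maker's
    turn has created. *)
Lemma potential_setU M B F (a b : nat) (c : R) :
  (0 < b)%N -> x ^+ b - 1 <= a%:R * (1 - y) -> 0 <= c ->
  [disjoint F & B] -> (#|F| <= b)%N ->
  (forall e, e \in F -> a%:R * ((1 - y) * elt_weight M B e) <= c) ->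
  potential M (B :|: F) <= potential M B + c.
Proof.
move=> b0 xy c0 FB Fb Fc.
rewrite -lerBlDl -(ler_pM2l (_ : 0 < b%:R)) ?ltr0n //.
have Uv v : weight M (B :|: F) v - weight M B v =
            weight M B v * (x ^+ #|A v :&: F| - 1).
  rewrite /weight setIUr cardsU.
  have -> : A v :&: B :&: (A v :&: F) = set0.
    by apply/eqP; rewrite setIACA setIid [B :&: F]setIC (disjoint_setI0 FB) setI0.
  by rewrite cards0 subn0 exprD; ring.
rewrite /potential -sumrB (eq_bigr _ (fun v _ => Uv v)).
apply: (@le_trans _ _ (\sum_v \sum_(e in F | e \in A v)
                         weight M B v * (x ^+ b - 1))).
  rewrite mulr_sumr ler_sum // => v _.
  rewrite mulrCA sumr_const -[in leRHS]mulrnAr ler_wpM2l ?weight_ge0 //.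
  have -> : #|[pred e in F | e \in A v]| = #|A v :&: F|.
    by apply: eq_card => e; rewrite !inE andbC.
  rewrite -[leRHS]mulr_natl expr_chord // (leq_trans _ Fb) //.
  by rewrite subset_leq_card // subsetIr.
rewrite (exchange_big_dep (mem F)) /=; last by move=> v e _ /andP[].
apply: (@le_trans _ _ (\sum_(e in F) c)).
  apply: ler_sum => e eF; apply: le_trans (Fc e eF).
  rewrite eF /= -mulr_suml -/(elt_weight M B e) mulrA mulrC.
  by rewrite ler_wpM2r ?sumr_ge0 // => v _; exact: weight_ge0.
by rewrite sumr_const -[leLHS]mulr_natl ler_wpM2r // ler_nat.
Qed.

End Potential.

(** * Bookkeeping along a play *)

Section Play.
Variables (T : finType) (E : {set T}).
Implicit Types (h : seq {set T}) (X : {set T}).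

Definition breaker_claimed h : {set T} :=
  \bigcup_(i < size h | odd i) nth set0 h i.

Lemma unclaimedE h : unclaimed E h = E :\: (maker_claimed h :|: breaker_claimed h).
Proof.
rewrite /unclaimed (big_nth set0) big_mkord; congr (_ :\: _).
by rewrite /maker_claimed /breaker_claimed (bigID (fun i : 'I_(size h) => odd i)) setUC.
Qed.

Lemma maker_claimed_rcons h X : maker_claimed (rcons h X) =
  if odd (size h) then maker_claimed h else maker_claimed h :|: X.
Proof.
rewrite /maker_claimed size_rcons big_mkcond big_ord_recr /= nth_rcons ltnn eqxx.
rewrite [in RHS]big_mkcond /=.
rewrite (eq_bigr (fun i : 'I_(size h) => if ~~ odd i then nth set0 h i else set0)).
  by case: (odd _) => //=; rewrite setU0.
by move=> i _; rewrite nth_rcons ltn_ord.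
Qed.

Lemma breaker_claimed_rcons h X : breaker_claimed (rcons h X) =
  if odd (size h) then breaker_claimed h :|: X else breaker_claimed h.
Proof.
rewrite /breaker_claimed size_rcons big_mkcond big_ord_recr /= nth_rcons ltnn eqxx.
rewrite [in RHS]big_mkcond /=.
rewrite (eq_bigr (fun i : 'I_(size h) => if odd i then nth set0 h i else set0)).
  by case: (odd _) => //=; rewrite setU0.
by move=> i _; rewrite nth_rcons ltn_ord.
Qed.

Lemma unclaimed_rcons h X : unclaimed E (rcons h X) = unclaimed E h :\: X.
Proof. by rewrite /unclaimed -cats1 big_cat /= big_seq1 setDDl. Qed.

Lemma legal_history_rcons a b h X : legal_history E a b (rcons h X) ->
  legal_history E a b h /\ legal_move E a b h X.
Proof.
move=> hX; split=> [i ih|].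
  have := hX i; rewrite size_rcons ltnS (ltnW ih) nth_rcons ih => /(_ isT).
  by rewrite -cats1 takel_cat // ltnW.
have := hX (size h); rewrite size_rcons ltnSn nth_rcons ltnn eqxx => /(_ isT).
by rewrite -cats1 take_size_cat.
Qed.

Lemma follows_maker_rcons s h X : follows_maker s (rcons h X) ->
  follows_maker s h /\ (~~ odd (size h) -> X = s h).
Proof.
move=> hX; split=> [i ih|].
  have := hX i; rewrite size_rcons ltnS (ltnW ih) nth_rcons ih => /(_ isT).
  by rewrite -cats1 takel_cat // ltnW.
have := hX (size h); rewrite size_rcons ltnSn nth_rcons ltnn eqxx => /(_ isT).
by rewrite -cats1 take_size_cat.
Qed.

Lemma maker_wins_sub a b (win win' : {set T} -> Prop) :
  (forall M, win M -> win' M) -> maker_wins E a b win -> maker_wins E a b win'.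
Proof. by move=> ww [s [s1 s2]]; exists s; split=> // h *; apply/ww/s2. Qed.

End Play.

(** * The greedy strategy *)

(** Invariant along a play: the potential is at most its initial value, and after
    Maker's turn the slack is large enough for [potential_setU], whatever free
    elements Breaker takes.  The final position is expressed with [A v :\: M], so
    that it depends on Maker's set only. *)
Theorem maker_wins_potential (R : realDomainType) (T V : finType) (E : {set T})
    (A : V -> {set T}) (a b : nat) (x y : R) :
  (0 < b)%N -> 1 <= x -> 0 <= y <= 1 -> x ^+ b - 1 <= a%:R * (1 - y) ->
  (forall v, A v \subset E) ->
  maker_wins E a b (fun M => \sum_v x ^+ #|A v :\: M| * y ^+ #|A v :&: M| <= #|V|%:R).
Proof.
move=> b0 x1 /andP[y0 y1] xy AE.
pose Mk := @maker_claimed T; pose Bk := @breaker_claimed T; pose U := @unclaimed T E.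
pose good h := good_reply A x y (Mk h) (Bk h) (U h) (minn a #|U h|).
pose s h : {set T} := odflt set0 [pick X | good h X].
have dis (P Q : {set T}) : [disjoint E :\: (P :|: Q) & P].
  rewrite disjoint_subset; apply/subsetP => e.
  by rewrite !inE negb_or => /andP[/andP[]].
have UM h : [disjoint U h & Mk h] by rewrite /U unclaimedE.
have UB h : [disjoint U h & Bk h] by rewrite /U unclaimedE setUC.
have s_good h : good h (s h).
  rewrite /s; case: pickP => [X //|none].
  have [X gX] := good_reply_exists A x1 y0 y1 (Bk h) (UM h) (geq_minr a #|U h|).
  by have := none X; rewrite /good gX.
exists s; split=> [h _ _ ev_h nover|h].
  rewrite /legal_move nover /bias (negPf ev_h).
  by have /and4P[-> -> _ _] := s_good h.
pose P h := potential A x y (Mk h) (Bk h).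
have inv : legal_history E a b h -> follows_maker s h -> P h <= #|V|%:R /\
    (odd (size h) -> forall e, e \in U h ->
       P h + a%:R * ((1 - y) * elt_weight A x y (Mk h) (Bk h) e) <= #|V|%:R).
  elim/last_ind: h => [_ _|h X IH /legal_history_rcons[lh lX] /follows_maker_rcons[fh fX]].
    split=> //; rewrite /P /potential /Mk /Bk /maker_claimed /breaker_claimed !big_ord0.
    by under eq_bigr do rewrite /weight !setI0 cards0 !expr0 mulr1; rewrite sumr_const.
  have [Ph Peh] := IH lh fh.
  have /and3P[_ XU /eqP cX] := lX.
  rewrite size_rcons /= /P /Mk /Bk /U maker_claimed_rcons breaker_claimed_rcons unclaimed_rcons.
  case: ifP => [odd_h|/negbT ev_h].
    split=> //.
    have {}Peh := Peh odd_h.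
    have -> : #|V|%:R = P h + (#|V|%:R - P h) by ring.
    apply: (potential_setU x1 y0 b0 xy); rewrite ?subr_ge0 //.
    - by rewrite (disjointWl XU).
    - by rewrite cX /bias odd_h geq_minl.
    by move=> e /(subsetP XU) eU; rewrite lerBrDl Peh.
  have /and4P[_ /eqP cs sP /forall_inP se] := s_good h.
  rewrite (fX ev_h); split=> [|_ e eUs]; first exact: le_trans sP Ph.
  apply: le_trans Ph; apply: le_trans (se _ eUs).
  (* If fewer than [a] elements are free, Maker takes them all and none is left. *)
  suff -> : minn a #|U h| = a by [].
  apply/minn_idPl; rewrite leqNgt; apply/negP => /ltnW/minn_idPr Ea.
  move: eUs; have /and4P[sU _ _ _] := s_good h.
  suff -> : s h = U h by rewrite setDv inE.
  by apply/eqP; rewrite eqEcard sU cs Ea leqnn.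
move=> lh fh; rewrite /game_over unclaimedE setD_eq0 => over.
apply: le_trans (proj1 (inv lh fh)); apply: ler_sum => v _.
rewrite ler_wpM2r ?exprn_ge0 // ler_weXn2l // subset_leq_card //.
apply/subsetP => e /setDP[eA eM]; rewrite inE eA /=.
by have := subsetP over e (subsetP (AE v) e eA); rewrite inE (negPf eM).
Qed.

(** * Choice of the rates *)

(** Only [exp z >= 1 + z] is used: it gives [exp t - 1 <= t / (1 - t)] and
    [a * (1 - exp (- u / a)) >= u / (1 + u / a) >= u / (1 + u)], and [u] is chosen
    so that [u / (1 + u) = t / (1 - t)]. *)
Lemma expR_rates_balanced (R : realType) (a t u : R) :
  1 <= a -> 0 <= t -> 2 * t < 1 -> u = t / (1 - 2 * t) ->
  expR t - 1 <= a * (1 - expR (- (u / a))).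
Proof.
move=> a1 t0 t1 uE.
have u0 : 0 <= u by rewrite uE divr_ge0 //; lra.
have le_inv (z w : R) : 0 < w -> w <= expR (- z) -> expR z <= w^-1.
  by move=> w0 wz; rewrite -[z in expR z]opprK expRN lef_pV2 ?posrE ?expR_gt0.
have et : expR t <= (1 - t)^-1.
  by apply: le_inv; [lra | exact: expR_ge1Dx].
have eu : expR (- (u / a)) <= (1 + u / a)^-1.
  have ua0 : 0 <= u / a by rewrite divr_ge0 //; lra.
  by apply: le_inv; [lra | rewrite opprK; exact: expR_ge1Dx].
apply: (@le_trans _ _ (u / (1 + u))).
  have -> : u / (1 + u) = (1 - t)^-1 - 1 by rewrite uE; field; lra.
  by rewrite lerD2r.
apply: (@le_trans _ _ (a * (1 - (1 + u / a)^-1))).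
  have -> : a * (1 - (1 + u / a)^-1) = u / (1 + u / a).
    by field; rewrite !lt0r_neq0 //; lra.
  have ua0 : 0 <= u / a by rewrite divr_ge0 //; lra.
  have ua1 : u / a <= u by rewrite ler_pdivrMr ?ler_peMr //; lra.
  by rewrite ler_wpM2l // lef_pV2 ?posrE; lra.
by rewrite ler_wpM2l ?lerD2l ?lerN2 //; lra.
Qed.

(** Here [L] stands for [ln n].  Writing [D] for the upper bound on [d], one has
    [t / b * (n - D) - u / a * D
       = n / (a + b) * (t - u) + 6 * sqrt (n * L) / (a + b) ^ (3 / 2) * (t * a + u * b)].
    The value of [t] makes the last term at least [2 * L], because [t <= u], and
    makes [n * t ^ 2 / (a + b)] equal to [L / 9].  As [u - t <= 4 * t ^ 2] when
    [4 * t <= 1], the first term costs at most [4 / 9 * L].  The requirement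
    [4 * t <= 1] follows from [2 * (a + b) * L <= n]; if [b > a], this uses that
    [D > 0] forces [18 * b * L < n]. *)
Lemma rates_exist (R : realType) (n a b L d : R) :
  0 < n -> 0 < a -> 0 < b -> 0 < L -> 4 * a * L <= n -> 0 < d ->
  d < a / (a + b) * n - 6 * a * b / ((a + b) `^ (3 / 2)) * Num.sqrt (n * L) ->
  exists t u, [/\ 0 <= t, 2 * t < 1, u = t / (1 - 2 * t), 0 <= u &
    L < t / b * (n - d) - u / a * d].
Proof.
move=> n0 a0 b0 L0 aL d0.
have s0 : 0 < a + b by lra.
have -> : (a + b) `^ (3 / 2) = (a + b) * Num.sqrt (a + b).
  have -> : 3 / 2 = 1 + 2^-1 :> R by field.
  by rewrite powRD ?(gt_eqF s0) ?implybT // powRr1 ?powR12_sqrt // ltW.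
have q0 : 0 < Num.sqrt (a + b) by rewrite sqrtr_gt0.
have q2 : Num.sqrt (a + b) ^+ 2 = a + b by rewrite sqr_sqrtr // ltW.
have S0 : 0 < Num.sqrt (n * L) by rewrite sqrtr_gt0 mulr_gt0.
have S2 : Num.sqrt (n * L) ^+ 2 = n * L by rewrite sqr_sqrtr // ltW ?mulr_gt0.
move: (Num.sqrt (a + b)) (Num.sqrt (n * L)) q0 q2 S0 S2 => q S q0 q2 S0 S2 dD.
set D := (X in _ < X) in dD.
have bS : 6 * b * S < n * q.
  have : 0 < D * ((a + b) * q / a) by rewrite !mulr_gt0 ?invr_gt0 // (lt_trans d0).
  have -> : D * ((a + b) * q / a) = n * q - 6 * b * S.
    by rewrite /D; field; rewrite !lt0r_neq0.
  lra.
have b2L : 36 * b ^+ 2 * L < n * (a + b).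
  have bS0 : 0 <= 6 * b * S by rewrite !mulr_ge0 // ltW.
  have : (6 * b * S) ^+ 2 < (n * q) ^+ 2 by rewrite ltr_pXn2r // ?nnegrE //; lra.
  rewrite !exprMn q2 S2 => h.
  rewrite -(ltr_pM2l n0); nra.
have sL : 2 * ((a + b) * L) <= n.
  have [ba|ab] := leP b a; first by nra.
  have : 18 * b * L < n by rewrite -(ltr_pM2l b0); nra.
  nra.
pose t := S * q / (3 * n).
have t0 : 0 < t by rewrite !mulr_gt0 // invr_gt0 mulr_gt0.
have t2 : t ^+ 2 = (a + b) * L / (9 * n).
  by rewrite /t !exprMn q2 S2 exprVn exprMn; field; rewrite lt0r_neq0.
have t4 : 4 * t <= 1.
  have : 18 * t ^+ 2 <= 1.
    by rewrite t2 mulrA ler_pdivrMr ?mulr_gt0 //; lra.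
  nra.
pose u := t / (1 - 2 * t).
have uE : u * (1 - 2 * t) = t by rewrite /u mulfVK // lt0r_neq0 //; lra.
have tu : t <= u by nra.
have ut : u - t <= 4 * t ^+ 2 by nra.
exists t, u; split => //; try lra.
have step : t / b * (n - D) - u / a * D < t / b * (n - d) - u / a * d.
  have : 0 < (t / b + u / a) * (D - d).
    by rewrite mulr_gt0 ?subr_gt0 // addr_gt0 // mulr_gt0 ?invr_gt0 //; lra.
  rewrite mulrDl !mulrBr; lra.
apply: lt_trans step.
have -> : t / b * (n - D) - u / a * D =
    n / (a + b) * (t - u) + 6 * S / ((a + b) * q) * (t * a + u * b).
  by rewrite /D; field; rewrite !lt0r_neq0.
have e1 : - (4 / 9 * L) <= n / (a + b) * (t - u).
  have -> : 4 / 9 * L = n / (a + b) * (4 * t ^+ 2).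
    by rewrite t2; field; rewrite !lt0r_neq0.
  rewrite -mulrN ler_wpM2l //; [by rewrite divr_ge0 // ltW | lra].
have e2 : 2 * L <= 6 * S / ((a + b) * q) * (t * a + u * b).
  have -> : 2 * L = 6 * S / ((a + b) * q) * (t * (a + b)).
    have -> : 2 * L = 2 * S ^+ 2 / n by rewrite S2; field; rewrite lt0r_neq0.
    by rewrite /t; field; rewrite !lt0r_neq0.
  rewrite ler_wpM2l //; first by rewrite divr_ge0 // ltW // mulr_gt0.
  by rewrite mulrDr lerD2l ler_wpM2r // ltW.
lra.
Qed.

(** * The degree game *)

Lemma card_incident_edges (n : nat) (v : 'I_n) :
  (n.-1 <= #|[set e in complete_edges n | v \in e]|)%N.
Proof.
have -> : n.-1 = #|[set~ v]| by rewrite cardsC1 card_ord.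
have inj : {in [set~ v] &, injective (fun u => [set v; u])}.
  move=> u w; rewrite !inE => uv wv /setP/(_ u).
  by rewrite !inE eqxx orbT (negPf uv) /= => /esym/eqP.
rewrite -(card_in_imset inj) subset_leq_card //.
apply/subsetP => e /imsetP[u uv ->]; move: uv; rewrite !inE eq_sym => uv.
by rewrite cards2 uv eqxx.
Qed.

Theorem lemma6 :
  exists n0 : nat, forall (R : realType) (n a b : nat) (d : int),
    (n0 <= n)%N -> (0 < a)%N -> (0 < b)%N ->
    (a%:R : R) <= n%:R / (4%:R * ln n%:R) ->
    (d%:~R : R) <
      a%:R / (a%:R + b%:R) * n%:R
      - 6%:R * a%:R * b%:R / ((a%:R + b%:R) `^ (3%:R / 2%:R))
        * Num.sqrt (n%:R * ln n%:R) ->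
    maker_wins_mindeg n a b d.
Proof.
exists 2%N => R n a b d n2 a0 b0 aL dD.
pose A (v : 'I_n) := [set e in complete_edges n | v \in e].
have AE v : A v \subset complete_edges n by apply/subsetP => e; rewrite inE => /andP[].
have degM M v : (#|A v :&: M| <= degree M v)%N.
  by rewrite subset_leq_card //; apply/subsetP => e; rewrite !inE => /andP[/andP[_ ->] ->].
(* If [d <= 0], any strategy wins; [x = y = 1] provides one. *)
have [d_le0|d_gt0] := leP d 0.
  have triv : (1 : R) ^+ b - 1 <= a%:R * (1 - 1) by rewrite expr1n subrr mulr0.
  have := maker_wins_potential b0 (lexx 1) _ triv AE.
  rewrite lexx ler01 => /(_ isT); apply: maker_wins_sub => M _ v.
  exact: le_trans d_le0 _.
case: d d_gt0 dD => // k; rewrite ltz_nat => k0 dD.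
have n0 : (0 : R) < n%:R by rewrite ltr0n (ltn_trans _ n2).
have L0 : (0 : R) < ln n%:R by rewrite ln_gt0 // ltr1n.
have [||||t [u [t0 t1 uE u0 Lt]]] := rates_exist n0 _ _ L0 _ _ dD; rewrite ?ltr0n //.
  by move: aL; rewrite ler_pdivlMr ?mulr_gt0 //; lra.
have aR : (1 : R) <= a%:R by rewrite ler1n.
have aR0 : (0 : R) < a%:R by rewrite ltr0n.
have bR0 : (0 : R) < b%:R by rewrite ltr0n.
have tb0 : 0 <= t / b%:R := divr_ge0 t0 (ltW bR0).
have ua0 : 0 <= u / a%:R := divr_ge0 u0 (ltW aR0).
have x1 : 1 <= expR (t / b%:R) by apply: le_trans (expR_ge1Dx _); rewrite lerDl.
have y01 : 0 <= expR (- (u / a%:R)) <= 1 by rewrite expR_ge0 expR_le1 oppr_le0.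
have xy : expR (t / b%:R) ^+ b - 1 <= a%:R * (1 - expR (- (u / a%:R))).
  rewrite -expRM_natl mulrC mulfVK ?gt_eqF //; exact: expR_rates_balanced.
apply: maker_wins_sub (maker_wins_potential b0 x1 y01 xy AE) => M potM v.
rewrite lez_nat leqNgt; apply/negP => deg_lt.
have m_lt : (#|A v :&: M| < k)%N := leq_ltn_trans (degM M v) deg_lt.
(* The loss of one edge from [n.-1] is made up for by [#|A v :&: M| <= k - 1]. *)
have c_gt : (n <= #|A v :\: M| + k)%N.
  apply: leq_trans (leqSpred n) (leq_ltn_trans (card_incident_edges v) _).
  by rewrite -/(A v) -(cardsID M (A v)) addnC ltn_add2l.
move: potM; apply/negP; rewrite -ltNge card_ord.
apply: (@lt_le_trans _ _
  (expR (t / b%:R) ^+ #|A v :\: M| * expR (- (u / a%:R)) ^+ #|A v :&: M|));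
  last first.
  rewrite (bigD1 v) //= lerDl sumr_ge0 // => w _.
  by rewrite mulr_ge0 // exprn_ge0 // expR_ge0.
rewrite -!expRM_natl -expRD -[ltLHS]lnK ?posrE // ltr_expR.
apply: lt_le_trans Lt _.
rewrite mulrN lerB //.
  by rewrite mulrC ler_wpM2r // lerBlDr -natrD ler_nat.
by rewrite mulrC ler_wpM2l // ler_nat ltnW.
Qed.
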